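(* Let $n\ge1$, let $\sigma$ be a permutation of $[n]$, let $1\le i\le n+1$, and let $\pi$ be the permutation of $[n+1]$ obtained by inserting $n+1$ into $\sigma$ at position $i$ (immediately before $\sigma_i$ if $i\le n$, at the end if $i=n+1$). Let $\ell\in\{a,x,y\}$ be the label of position $i$ in the $A$-labeling of $\sigma$, and let $G(\ell)$ be its image under the substitution rules $a\to ax$, $x\to xy$, $y\to x^2$. Then the weight of $\pi$ equals $\mathrm{wt}(\sigma)\cdot G(\ell)/\ell$, i.e. it is obtained from the weight of $\sigma$ by applying the substitution rule to the label at position $i$.
   Context: For a permutation $\sigma=\sigma_1\cdots\sigma_n$, position $j$ ($1\le j\le n$) is the slot immediately before $\sigma_j$ and position $n+1$ is the slot after $\sigma_n$. Set $\sigma_0=0$. The $A$-labeling assigns to each position $1,\dots,n+1$ one label from $\{a,x,y\}$ as follows, considering the maximal monotone segments (runs) $\sigma_i\sigma_{i+1}\cdots\sigma_j$ ($0\le i<j\le n$) of $\sigma_0\sigma_1\cdots\sigma_n$. For an increasing run with $j<n$: positions $i+1,\dots,j-1$ get $y$ and position $j$ gets $x$. For an increasing run with $j=n$: position $n$ gets $a$, position $n+1$ gets $x$, and positions $i+1,\dots,n-1$ get $y$. For a decreasing run: position $i+1$ gets $x$ and positions $i+2,\dots,j$ get $y$; if moreover $j=n$, position $n+1$ gets $a$. (Example: $\sigma=3\,7\,5\,8\,6\,1\,4\,9\,2$ is labeled $0\,y\,3\,x\,7\,x\,5\,x\,8\,x\,6\,y\,1\,y\,4\,x\,9\,x\,2\,a$.)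 The weight $\mathrm{wt}(\sigma)$ is the product of all labels, a monomial in $a,x,y$. *)

(* Defs.v *)
From mathcomp Require Import all_boot all_order all_fingroup all_algebra.
From mathcomp Require Import zify.
From mathcomp Require Import mpoly.

Set Implicit Arguments.
Unset Strict Implicit.
Unset Printing Implicit Defensive.

Import GRing.Theory.

(* A permutation of [n] is s : 'S_n; its one-line word uses the letters 1, ..., n. *)
Definition one_line (n : nat) (s : 'S_n) : seq nat :=
  [seq (s i).+1 | i <- enum 'I_n].

(* Positions are numbered from 1; position (size w).+1 is the end of the word. *)
Definition insert_at (i v : nat) (w : seq nat) : seq nat :=
  take i.-1 w ++ v :: drop i.-1 w.

Definition entry (w : seq nat) (k : nat) : nat := nth 0 (0 :: w) k.

Definition increasing (w : seq nat) (i j : nat) : bool :=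
  all (fun k => entry w k < entry w k.+1) (iota i (j - i)).

Definition decreasing (w : seq nat) (i j : nat) : bool :=
  all (fun k => entry w k > entry w k.+1) (iota i (j - i)).

(* The pair (i, j) stands for the factor w_i w_(i+1) ... w_j of w_0 w_1 ... w_n. *)
Definition monotone (w : seq nat) (r : nat * nat) : bool :=
  [&& r.1 < r.2, r.2 <= size w & increasing w r.1 r.2 || decreasing w r.1 r.2].

Definition factors (n : nat) : seq (nat * nat) :=
  [seq (i, j) | i <- iota 0 n.+1, j <- iota 0 n.+1].

Definition is_run (w : seq nat) (r : nat * nat) : bool :=
  monotone w r &&
  all (fun q => [&& monotone w q, q.1 <= r.1 & r.2 <= q.2] ==> (q == r))
      (factors (size w)).

(* The run (i, j) labels the positions i+1, ..., j, and the last run also labels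
   the end position. *)
Definition labels_position (w : seq nat) (r : nat * nat) (k : nat) : bool :=
  (r.1 < k <= r.2) || (r.2 == size w) && (k == (size w).+1).

Variant letter := La | Lx | Ly.

Definition run_label (w : seq nat) (r : nat * nat) (k : nat) : letter :=
  let: (i, j) := r in
  let n := size w in
  if increasing w i j then
    if j < n then (if k == j then Lx else Ly)
    else if k == n.+1 then Lx else if k == n then La else Ly
  else
    if k == i.+1 then Lx else if k == n.+1 then La else Ly.

(* Exactly one run labels a given position (run_of_unique, run_of_exists), so
   taking the first one in the list involves no choice. *)
Definition run_of (w : seq nat) (k : nat) : nat * nat :=
  head (0, 0)
    [seq r <- factors (size w) | is_run w r && labels_position w r k].

Definition A_label (w : seq nat) (k : nat) : letter := run_label w (run_of w k) k.

Definition A_labeling (w : seq nat) : seq letter :=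
  [seq A_label w k | k <- iota 1 (size w).+1].

Example A_labeling_ex :
  A_labeling [:: 3; 7; 5; 8; 6; 1; 4; 9; 2] =
  [:: Ly; Lx; Lx; Lx; Lx; Ly; Ly; Lx; Lx; La].
Proof. by vm_compute. Qed.

Local Open Scope ring_scope.

(* The monomial ring is Z[a, x, y], with a, x, y the variables 0, 1, 2. *)
Definition monom (l : letter) : {mpoly int[3]} :=
  match l with
  | La => 'X_(inord 0)
  | Lx => 'X_(inord 1)
  | Ly => 'X_(inord 2)
  end.

Definition subst_rule (l : letter) : {mpoly int[3]} :=
  match l with
  | La => monom La * monom Lx
  | Lx => monom Lx * monom Ly
  | Ly => monom Lx ^+ 2
  end.

Definition wt (n : nat) (s : 'S_n) : {mpoly int[3]} :=
  \prod_(1 <= k < n.+2) monom (A_label (one_line s) k).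

Local Open Scope nat_scope.

Lemma size_one_line n (s : 'S_n) : size (one_line s) = n.
Proof. by rewrite size_map size_enum_ord. Qed.

Lemma one_line_perm n (s : 'S_n) : perm_eq (one_line s) (iota 1 n).
Proof.
apply: uniq_perm; [|exact: iota_uniq|].
  rewrite map_inj_uniq ?enum_uniq // => i j [] /ord_inj; exact: perm_inj.
move=> k; rewrite mem_iota; apply/mapP/idP => [[i _ ->]|].
  by have := ltn_ord (s i); lia.
case: k => // k; rewrite add1n ltnS /= => kn'; have kn : k < n by lia.
by exists (s^-1 (Ordinal kn))%g; rewrite ?mem_enum // permKV.
Qed.

Lemma one_line_inj n : injective (@one_line n).
Proof.
move=> s t /eq_in_map E; apply/permP => i.
by apply: ord_inj; have [] := E i (mem_enum _ i).
Qed.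

Lemma one_line_insert n (s : 'S_n) (i : nat) : 1 <= i <= n.+1 ->
  one_line (lift_perm (inord i.-1) ord_max s) = insert_at i n.+1 (one_line s).
Proof.
move=> /andP[i1 iN].
have sz : size (take i.-1 (one_line s)) = i.-1.
  by rewrite size_takel ?size_one_line //; lia.
have E m (t : 'S_m) (x : 'I_m) : nth 0 (one_line t) x = (t x).+1.
  by rewrite (nth_map x) ?size_enum_ord // nth_ord_enum.
apply: (@eq_from_nth _ 0).
  rewrite size_one_line size_cat sz /= size_drop size_one_line; lia.
move=> k; rewrite size_one_line => kn.
rewrite (E _ _ (Ordinal kn)) nth_cat sz.
case: (unliftP (inord i.-1) (Ordinal kn)) => [j|] /[dup] Ek ->.
  rewrite lift_perm_lift /=.
  have := congr1 val Ek; rewrite /= inordK; last by lia.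
  have Hs : bump n (s j) = s j by rewrite /bump; have := ltn_ord (s j); lia.
  rewrite Hs /bump => ->; have [ji|ji] := leqP i.-1 j.
    rewrite -[nat_of_bool true]/1 add1n ltnNge (leqW ji) subSn //.
    by rewrite /= nth_drop subnKC // E.
  by rewrite -[nat_of_bool false]/0 add0n ji nth_take ?E.
rewrite lift_perm_id /=.
have := congr1 val Ek; rewrite /= inordK; last by lia.
by move=> ->; rewrite ltnn subnn.
Qed.

Lemma mem_factors n r : (r \in factors n) = (r.1 <= n) && (r.2 <= n).
Proof.
have E m : (m \in iota 0 n.+1) = (m <= n) by rewrite mem_iota ltnS.
rewrite /factors; case: r => i j; apply/allpairsP/idP => [[q []]|/andP[Hi Hj]].
  by rewrite !E => ? ? [-> ->]; apply/andP.
by exists (i, j); rewrite !E.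
Qed.

Lemma monotone_factors w r : monotone w r -> r \in factors (size w).
Proof. by rewrite mem_factors => /and3P[r12 rn _]; rewrite rn (leq_trans (ltnW r12)). Qed.

Lemma is_runP w r : reflect
  (monotone w r /\
   forall q, monotone w q -> q.1 <= r.1 -> r.2 <= q.2 -> q = r) (is_run w r).
Proof.
apply: (iffP andP) => -[mr H]; split=> //.
  move=> q mq q1 q2; apply/eqP; move/allP: H => /(_ q (monotone_factors mq)).
  by rewrite mq q1 q2.
by apply/allP => q _; apply/implyP => /and3P[mq q1 q2]; apply/eqP/H.
Qed.

Lemma all_segP (P : pred nat) i j :
  reflect (forall k, i <= k < j -> P k) (all P (iota i (j - i))).
Proof.
apply: (iffP allP) => H k; first by move=> ?; apply: H; rewrite mem_iota; lia.
by rewrite mem_iota => ?; apply: H; lia.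
Qed.

Lemma monotone_join w q r k : monotone w q -> monotone w r ->
  q.1 < k <= q.2 -> r.1 < k <= r.2 ->
  monotone w (minn q.1 r.1, maxn q.2 r.2).
Proof.
case: q r => [a b] [c d] /and3P[/= ab bn Hq] /and3P[/= cd dn Hr] kq kr.
apply/and3P; split; rewrite /=; [lia|lia|].
case/orP: Hq => /all_segP Hq; case/orP: Hr => /all_segP Hr; apply/orP.
- left; apply/all_segP => m Hm; have [?|?] := boolP (a <= m < b); first exact: Hq.
  by apply: Hr; lia.
- by have := Hq k.-1; have := Hr k.-1; lia.
- by have := Hq k.-1; have := Hr k.-1; lia.
- right; apply/all_segP => m Hm; have [?|?] := boolP (a <= m < b); first exact: Hq.
  by apply: Hr; lia.
Qed.

Lemma labels_position_min w r k : monotone w r -> labels_position w r k ->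
  r.1 < minn k (size w) <= r.2.
Proof. by move=> /and3P[? ? _]; rewrite /labels_position; lia. Qed.

Lemma run_unique w q r k : is_run w q -> is_run w r ->
  labels_position w q k -> labels_position w r k -> q = r.
Proof.
move=> /is_runP[mq Hq] /is_runP[mr Hr] /(labels_position_min mq) kq.
move=> /(labels_position_min mr) kr; have mj := monotone_join mq mr kq kr.
by rewrite -[LHS](Hq _ mj) ?geq_minl ?leq_maxl // (Hr _ mj) ?geq_minr ?leq_maxr.
Qed.

Lemma run_exists w k : uniq (0 :: w) -> 0 < size w -> 1 <= k <= (size w).+1 ->
  exists2 r, is_run w r & labels_position w r k.
Proof.
move=> Uw w0 Hk; pose m := minn k (size w).
have [m0 mn] : 0 < m /\ m <= size w by rewrite /m; lia.
have m1 : monotone w (m.-1, m).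
  apply/and3P; split; rewrite /=; [lia|by []|].
  have ne : entry w m.-1 != entry w m.
    by rewrite /entry nth_uniq //=; lia.
  rewrite /increasing /decreasing (_ : m - m.-1 = 1); last by lia.
  by rewrite /= prednK // !andbT -neq_ltn.
pose P d := has (fun r => [&& monotone w r, r.1 < m <= r.2 & r.2 - r.1 == d])
                (factors (size w)).
have exP : exists d, P d.
  exists (m - m.-1); apply/hasP; exists (m.-1, m); first exact: monotone_factors.
  by rewrite m1 /=; lia.
have ubP d : P d -> d <= size w.
  by case/hasP => r _ /and3P[/and3P[? ? _] ? /eqP <-]; lia.
case: (ex_maxnP exP ubP) => d /hasP[r _ /and3P[mr rm /eqP rd]] Hd.
exists r; last first.
  by case/and3P: mr => ? ? _; move: rm; rewrite /labels_position /m; lia.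
apply/is_runP; split=> // q mq q1 q2.
have /Hd : P (q.2 - q.1).
  apply/hasP; exists q; first exact: monotone_factors.
  by rewrite mq eqxx andbT /=; lia.
case/and3P: mr => ? ? _; case/and3P: mq => ? ? _.
by move=> qd; apply: (@injective_projections nat nat); lia.
Qed.

Lemma run_of_unique w r k : is_run w r -> labels_position w r k -> run_of w k = r.
Proof.
move=> Rr Lr; rewrite /run_of.
have : r \in [seq r <- factors (size w) | is_run w r && labels_position w r k].
  by rewrite mem_filter Rr Lr monotone_factors //; case/is_runP: Rr.
case E: [seq _ <- _ | _] => [//|q s] _ /=.
have : q \in [seq r <- factors (size w) | is_run w r && labels_position w r k].
  by rewrite E mem_head.
by rewrite mem_filter => /andP[/andP[Rq Lq] _]; apply: run_unique Lq Lr.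
Qed.

Lemma run_of_exists n (s : 'S_n) k : 0 < n -> 1 <= k <= n.+1 ->
  is_run (one_line s) (run_of (one_line s) k) /\
  labels_position (one_line s) (run_of (one_line s) k) k.
Proof.
move=> n0 kn; have [|||r Rr Lr] := @run_exists (one_line s) k.
- rewrite /= (perm_mem (one_line_perm s)) mem_iota /=.
  by rewrite (perm_uniq (one_line_perm s)) iota_uniq.
- by rewrite size_one_line.
- by rewrite size_one_line.
by rewrite (run_of_unique Rr Lr).
Qed.

(* Main.v *)
(* The label of position p depends only on the directions of the two or three
   steps of 0 w_1 ... w_n next to it.  Inserting n+1 at position i puts an ascent
   followed by a descent in place of one step and leaves all other steps alone,
   so it only affects the labels of the old positions i-1, i and i+1, and the
   claim is a case analysis on the neighbouring steps. *)
Require Import Defs.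
From mathcomp Require Import all_boot all_order all_fingroup all_algebra.
From mathcomp Require Import zify ring.
From mathcomp Require Import mpoly.
Import GRing.Theory.

Set Implicit Arguments.
Unset Strict Implicit.

Local Open Scope nat_scope.

(** * Labels read off from neighbouring ascents and descents *)

Definition ascent (w : seq nat) (k : nat) : bool := entry w k < entry w k.+1.

(* In the last branch [p.-2] never truncates: step 0 is an ascent. *)
Definition local_label (w : seq nat) (p : nat) : letter :=
  if p == (size w).+1 then (if ascent w (size w).-1 then Lx else La)
  else if ascent w p.-1 then
    (if p == size w then La else if ascent w p then Ly else Lx)
  else if ascent w p.-2 then Lx else Ly.

Lemma entry_neq w k : uniq (0 :: w) -> k < size w -> entry w k != entry w k.+1.
Proof. by move=> Uw kw; rewrite /entry nth_uniq //=; lia. Qed.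

Lemma ascent0 w : uniq (0 :: w) -> 0 < size w -> ascent w 0.
Proof. by move=> Uw /(entry_neq Uw); rewrite /ascent /entry /=; lia. Qed.

(** An ascent at step [j] would extend the run to [j.+1], against maximality. *)
Lemma increasing_run_end w i j : is_run w (i, j) -> increasing w i j ->
  j < size w -> ~~ ascent w j.
Proof.
move=> /is_runP[/and3P[/= ij jn _] Hmax] /all_segP inc jw.
apply/negP => aj; suff /Hmax /= : monotone w (i, j.+1).
  by move=> /(_ (leqnn _) (leqnSn _)) []; lia.
apply/and3P; split=> //=; first by lia.
apply/orP; left; apply/all_segP => k Hk.
by have [->//|?] := eqVneq k j; apply: inc; lia.
Qed.

(** The initial [0] is followed by an ascent, so no decreasing run starts there; a descent at step
    [i.-1] would extend the run to the left. *)
Lemma decreasing_run_start w i j : uniq (0 :: w) ->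
  is_run w (i, j) -> decreasing w i j -> 0 < i /\ ascent w i.-1.
Proof.
move=> Uw /is_runP[/and3P[/= ij jn _] Hmax] /all_segP dec.
have i0 : 0 < i.
  by case: i ij dec {Hmax} => // ? /(_ 0); have := ascent0 Uw; rewrite /ascent; lia.
split=> //; apply/negPn/negP => ai.
suff /Hmax /= : monotone w (i.-1, j).
  by move=> /(_ (leq_pred _) (leqnn _)) []; lia.
apply/and3P; split=> //=; first by lia.
apply/orP; right; apply/all_segP => k Hk.
have [?|?] := eqVneq k i.-1; last by apply: dec; lia.
by subst k; have := @entry_neq w i.-1 Uw; move: ai; rewrite /ascent; lia.
Qed.

(** Steps inside a run share one direction, which flips where an increasing run stops before the end
    of the word and where a decreasing run starts; so the steps next to [p] reveal its place in the
    run. *)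
Lemma A_labelE w p : uniq (0 :: w) -> 0 < size w -> 1 <= p <= (size w).+1 ->
  A_label w p = local_label w p.
Proof.
move=> Uw w0 Hp; have [[i j] Rr Lr] := run_exists Uw w0 Hp.
rewrite /A_label (run_of_unique Rr Lr) /run_label /local_label.
have [/and3P[/= ij jn Hmono] _] := is_runP _ _ Rr.
move: Lr; rewrite /labels_position /= => Lr.
have [inc|ninc] := boolP (increasing w i j).
  have Hend := increasing_run_end Rr inc.
  have {}inc k : i <= k < j -> ascent w k by move/all_segP: inc; apply.
  have [jw|jw] := ltnP j (size w).
    have [pn1 pn] : (p == (size w).+1) = false /\ (p == size w) = false by lia.
    rewrite pn1 pn [ascent w p.-1]inc; last by lia.
    by have [->|?] := eqVneq p j; [rewrite (negbTE (Hend jw))|rewrite inc //; lia].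
  have [pn|pn] := eqVneq p (size w).+1; first by rewrite inc //; lia.
  rewrite [ascent w p.-1]inc; last by lia.
  by have [//|?] := eqVneq p (size w); rewrite inc //; lia.
have dec : decreasing w i j by move: Hmono; rewrite (negbTE ninc).
have [i0 ai] := decreasing_run_start Uw Rr dec.
have {}dec k : i <= k < j -> ascent w k = false.
  by move=> /(all_segP _ _ _ dec); rewrite /ascent; lia.
have [pn|pn] := eqVneq p (size w).+1.
  by rewrite dec ?ifF //; lia.
rewrite [ascent w p.-1]dec; last by lia.
have [->|?] := eqVneq p i.+1; first by rewrite ai.
by rewrite dec //; lia.
Qed.

(** * Words with one inserted letter *)

Lemma size_insert_at i v w : size (insert_at i v w) = (size w).+1.
Proof. by rewrite size_cat /= addnS -size_cat cat_take_drop. Qed.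

Lemma entry_insert_at i v w k : 1 <= i <= (size w).+1 ->
  entry (insert_at i v w) k =
  if k < i then entry w k else if k == i then v else entry w k.-1.
Proof.
move=> Hi; case: k => [|k]; first by rewrite ifT //; lia.
rewrite /entry /insert_at /= nth_cat size_takel; last by lia.
have [ki|ki] := ltnP k i.-1; first by rewrite nth_take // ifT //; lia.
rewrite ifF; last by lia.
have [?|kni] := eqVneq k.+1 i; first by rewrite (_ : k - i.-1 = 0) //; lia.
case: k ki kni => [|k] ki kni; first by lia.
rewrite subSn; last by lia.
by rewrite /= nth_drop subnKC //; lia.
Qed.

(** * Steps and labels after inserting a strictly largest letter *)

Section InsertMax.
Variables (w : seq nat) (v i : nat).
Hypotheses (w_lt_v : forall k, entry w k < v) (Hi : 1 <= i <= (size w).+1).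
Let w' := insert_at i v w.

Lemma ascent_insert_max k : ascent w' k =
  if k.+1 < i then ascent w k else if k.+1 == i then true
  else if k == i then false else ascent w k.-1.
Proof.
rewrite /ascent !entry_insert_at //.
have [?|?] := ltnP k.+1 i; first by rewrite ifT //; lia.
have [?|?] := eqVneq k.+1 i; first by rewrite ifT ?w_lt_v //; lia.
rewrite ifF; last by lia.
(* If [i] is the end position, [entry w i] is the default [0], still below [v]: the step past the
   end is no ascent. *)
have [->|?] := eqVneq k i; first by rewrite /= ltnNge ltnW ?w_lt_v.
by rewrite prednK //; lia.
Qed.

Let ascent_before k : k.+1 < i -> ascent w' k = ascent w k.
Proof. by move=> ki; rewrite ascent_insert_max ki. Qed.

Let ascent_to : ascent w' i.-1.
Proof. by rewrite ascent_insert_max ifF ?ifT //; lia. Qed.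

Let ascent_from : ascent w' i = false.
Proof. by rewrite ascent_insert_max ltnNge leqnSn gtn_eqF // eqxx. Qed.

Let ascent_after k : i <= k -> ascent w' k.+1 = ascent w k.
Proof. by move=> ik; rewrite ascent_insert_max !ifF //; lia. Qed.

Lemma local_label_insert_before p : 1 <= p -> p.+1 < i ->
  local_label w' p = local_label w p.
Proof.
move=> p0 pi; rewrite /local_label size_insert_at.
have [-> ->] : (p == (size w).+2) = false /\ (p == (size w).+1) = false by lia.
have -> : (p == size w) = false by lia.
by rewrite !ascent_before //; lia.
Qed.

(** Step [i.-1] is now an ascent. After an ascent at [i.-2] this puts position [i.-1] inside an
    increasing run; after a descent its label ignores step [i.-1]. *)
Lemma local_label_insert_prev : 1 < i ->
  local_label w' i.-1 = if ascent w i.-2 then Ly else local_label w i.-1.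
Proof.
move=> i1; rewrite /local_label size_insert_at ascent_to.
have [-> ->] : (i.-1 == (size w).+2) = false /\ (i.-1 == (size w).+1) = false by lia.
by rewrite !ascent_before; [case: ifP|lia..].
Qed.

Lemma local_label_insert_max :
  local_label w' i = if i == (size w).+1 then La else Lx.
Proof.
rewrite /local_label size_insert_at ascent_to ascent_from.
by have -> : (i == (size w).+2) = false by lia.
Qed.

(** Either a decreasing run starts at [v], or [v] is the last letter and this is the end position
    after an ascent. *)
Lemma local_label_insert_succ : local_label w' i.+1 = Lx.
Proof.
rewrite /local_label size_insert_at /= ascent_to ascent_from.
by case: eqP => // -[iw]; move: ascent_to; rewrite iw /= => ->.
Qed.

(** The step before [w_i] now comes from [v] and is a descent. This matters only at the new end
    position or if step [i] of [w] is a descent, which then continues a decreasing run. *)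
Lemma local_label_insert_next : i <= size w ->
  local_label w' i.+2 =
  if i == size w then La else if ascent w i then local_label w i.+1 else Ly.
Proof.
move=> iw; rewrite /local_label size_insert_at /= !eqSS ascent_from.
have [<-|iw'] := eqVneq i (size w); first by rewrite ascent_from.
by rewrite !ascent_after //; case: ifP.
Qed.

Lemma local_label_insert_after p : i.+1 < p <= (size w).+1 ->
  local_label w' p.+1 = local_label w p.
Proof.
case: p => [//|[//|p]] /andP[ip pw].
rewrite /local_label size_insert_at /= !eqSS !ascent_after; [|lia..].
case: eqP => // pw'; case: (size w) pw' => // m [<-].
by rewrite ascent_after //; lia.
Qed.

(** * Weights on the two sides of the inserted letter *)

Hypotheses (w0 : 0 < size w) (asc0 : ascent w 0).

Local Notation weight u a b := (\prod_(a <= k < b) monom (local_label u k))%R.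

(* If w_(i-1) (resp. w_i) is a peak, v takes over that role: the label at the
   old position i-1 (resp. i+1) becomes y.  The end of the word counts as a
   descent. *)
Let peak_before := ((i == (size w).+1) || ~~ ascent w i.-1) && ascent w i.-2.

Let peak_after := ascent w i.-1 && ((i == size w) || ~~ ascent w i).

Lemma weight_before_no_peak : ~~ peak_before -> weight w' 1 i = weight w 1 i.
Proof.
move=> Hc; apply: eq_big_nat => p /andP[p1 pi]; congr monom.
have [pi1|?] := eqVneq p i.-1; last by rewrite local_label_insert_before //; lia.
have [i1 ni2] : 1 < i /\ (i.-1 == (size w).+1) = false by lia.
rewrite pi1 local_label_insert_prev // /local_label ni2.
move: Hc; rewrite /peak_before; case: (ascent w i.-2) => //.
rewrite andbT => /norP[/negbTE ni /negPn ->].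
by have -> : (i.-1 == size w) = false by lia.
Qed.

Lemma weight_before_peak : peak_before -> exists Q,
  weight w 1 i = (Q * monom (if i == (size w).+1 then La else Lx))%R /\
  weight w' 1 i = (Q * monom Ly)%R.
Proof.
move=> /andP[Hc asc]; exists (weight w 1 i.-1).
(* At [i = 1] both [i.-1] and the truncated [i.-2] are step [0], an ascent, and [w] is nonempty, so
   [peak_before] fails. *)
have i1 : 1 < i.
  by case: (ltngtP 1 i) Hi Hc => [//||<-] //=; rewrite ?asc0; lia.
have Ei : i = i.-1.+1 by lia.
split; rewrite [in LHS]Ei big_nat_recr; try lia; congr (_ * monom _)%R.
- rewrite /local_label asc.
  have -> : (i.-1 == (size w).+1) = false by lia.
  have -> : (i.-1 == size w) = (i == (size w).+1) by lia.
  by case: eqP Hc => //= _ /negbTE ->.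
- by apply: eq_big_nat => p Hp; rewrite local_label_insert_before //; lia.
- by rewrite local_label_insert_prev // asc.
Qed.

Lemma weight_after_no_peak : ~~ peak_after ->
  weight w' i.+2 (size w).+3 = weight w i.+1 (size w).+2.
Proof.
move=> Hc; rewrite big_add1 /=; apply: eq_big_nat => p /andP[ip pw]; congr monom.
have [?|?] := eqVneq p i.+1; last by rewrite local_label_insert_after //; lia.
subst p; rewrite local_label_insert_next; last by lia.
move: Hc; rewrite /peak_after /local_label eqSS /=.
have [<-|_] := eqVneq i (size w); first by rewrite andbT => /negbTE ->.
by case: (ascent w i) => //; rewrite andbT => /negbTE ->.
Qed.

Lemma weight_after_peak : i <= size w -> peak_after -> exists Q,
  weight w i.+1 (size w).+2 = (monom Lx * Q)%R /\
  weight w' i.+2 (size w).+3 = (monom (if i == size w then La else Ly) * Q)%R.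
Proof.
move=> iw /andP[asc Hc]; exists (weight w i.+2 (size w).+2).
split; rewrite big_ltn ?ltnS //; congr (monom _ * _)%R.
- rewrite /local_label eqSS /= asc; have [iw'|iw'] := eqVneq i (size w).
    by rewrite -iw' asc.
  by move: Hc; rewrite (negbTE iw') => /negbTE ->.
- by rewrite local_label_insert_next //; case: eqP Hc => //= _ /negbTE ->.
- rewrite big_add1; apply: eq_big_nat => p Hp.
  by rewrite local_label_insert_after //; lia.
Qed.

(** Positions [i] and [i.+1] of [w'] carry x and x, or a and x at the end. With no adjacent peak the
    old label is y, or a at the end, and this is already its image. Otherwise exactly one side has a
    peak, and the single label changed there supplies the missing factor. *)
Lemma weight_insert_max :
  (weight w' 1 (size w).+3 =
   weight w 1 i * subst_rule (local_label w i) * weight w i.+1 (size w).+2)%R.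
Proof.
rewrite (@big_cat_nat _ _ _ i) /=; [|lia..].
rewrite (@big_ltn _ _ _ i); last by lia.
rewrite (@big_ltn _ _ _ i.+1); last by lia.
rewrite local_label_insert_max local_label_insert_succ.
have [iw|iw] := eqVneq i (size w).+1.
  rewrite [weight w i.+1 _]big_geq ?[weight w' i.+2 _]big_geq; [|lia..].
  have -> : local_label w i = if ascent w i.-2 then Lx else La.
    by rewrite /local_label iw eqxx.
  have [pk|pk] := boolP peak_before.
    have [Q [-> ->]] := weight_before_peak pk.
    by move: pk => /andP[_ ->]; rewrite iw eqxx /=; ring.
  rewrite weight_before_no_peak //.
  by move: pk; rewrite /peak_before iw eqxx /= => /negbTE ->; rewrite /=; ring.
have {}iw : i <= size w by lia.
have nw : (i == (size w).+1) = false by lia.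
have El : local_label w i = if ascent w i.-1 then
    (if i == size w then La else if ascent w i then Ly else Lx)
  else if ascent w i.-2 then Lx else Ly by rewrite /local_label nw.
have [asc|dsc] := boolP (ascent w i.-1).
  rewrite weight_before_no_peak; last by rewrite /peak_before nw asc.
  rewrite El asc; have [vl|vl] := boolP peak_after.
    have [Q [-> ->]] := weight_after_peak iw vl.
    move: vl; rewrite /peak_after asc.
    by case: eqP => [_ _|_ /= /negbTE ->]; rewrite /=; ring.
  rewrite weight_after_no_peak //.
  move: vl; rewrite /peak_after asc /= negb_or negbK => /andP[/negbTE -> ->].
  by rewrite /=; ring.
rewrite weight_after_no_peak; last by rewrite /peak_after (negbTE dsc).
rewrite El (negbTE dsc); have [pk|pk] := boolP peak_before.
  have [Q [-> ->]] := weight_before_peak pk.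
  by move: pk => /andP[_ ->]; rewrite nw /=; ring.
rewrite weight_before_no_peak //.
move: pk; rewrite /peak_before dsc orbT /= => /negbTE ->.
by rewrite /=; ring.
Qed.

End InsertMax.

(** * Transfer to permutations *)

Lemma uniq_one_line n (s : 'S_n) : uniq (0 :: one_line s).
Proof.
rewrite /= (perm_mem (one_line_perm s)) mem_iota /=.
by rewrite (perm_uniq (one_line_perm s)) iota_uniq.
Qed.

Lemma entry_one_line_le n (s : 'S_n) k : entry (one_line s) k <= n.
Proof.
case: k => [|k] //; rewrite /entry /=.
have [kn|kn] := ltnP k (size (one_line s)); last by rewrite nth_default.
by have := mem_nth 0 kn; rewrite (perm_mem (one_line_perm s)) mem_iota add1n ltnS => /andP[].
Qed.

Lemma wt_local n (s : 'S_n) : 0 < n ->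
  wt s = (\prod_(1 <= k < n.+2) monom (local_label (one_line s) k))%R.
Proof.
move=> n0; apply: eq_big_nat => k Hk.
by rewrite A_labelE ?uniq_one_line ?size_one_line.
Qed.

Lemma monom_neq0 l : monom l != 0%R.
Proof. by case: l; rewrite /= -msupp_eq0 msuppX. Qed.

Unset Implicit Arguments.
Local Open Scope ring_scope.

(** The quotient by the old label is taken in the fraction field, hence [tofrac]; the second
    conjunct expresses replacing one label within the polynomial ring. *)
Theorem theorem4p1 (n : nat) (sigma : 'S_n) (i : nat) (pi : 'S_n.+1) :
  (1 <= n)%N ->
  (1 <= i <= n.+1)%N ->
  one_line pi = insert_at i n.+1 (one_line sigma) ->
  let l := A_label (one_line sigma) i in
  tofrac (wt pi) = tofrac (wt sigma) * tofrac (subst_rule l) / tofrac (monom l)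
  /\
  wt pi = (\prod_(1 <= k < i) monom (A_label (one_line sigma) k)) * subst_rule l *
          (\prod_(i.+1 <= k < n.+2) monom (A_label (one_line sigma) k)).
Proof.
move=> n0 Hi Epi l.
(* The polynomial identity comes first; the quotient form follows by splitting [wt sigma] at
   position [i] and cancelling the nonzero [monom l]. *)
have Ewt : wt pi =
    (\prod_(1 <= k < i) monom (A_label (one_line sigma) k)) * subst_rule l *
    (\prod_(i.+1 <= k < n.+2) monom (A_label (one_line sigma) k)).
  have labE k : (1 <= k <= n.+1)%N ->
      A_label (one_line sigma) k = local_label (one_line sigma) k.
    by move=> Hk; rewrite A_labelE ?uniq_one_line ?size_one_line.
  rewrite wt_local // Epi.
  have := @weight_insert_max (one_line sigma) n.+1 i.
  rewrite size_one_line => -> //; last first.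
  - by rewrite ascent0 ?uniq_one_line ?size_one_line.
  - by move=> k; rewrite ltnS entry_one_line_le.
  congr (_ * _ * _); last 1 first.
  - by apply: eq_big_nat => k Hk; rewrite labE //; lia.
  - by apply: eq_big_nat => k Hk; rewrite labE //; lia.
  - by rewrite /l labE.
split=> //; rewrite {}Ewt.
have -> : wt sigma =
    (\prod_(1 <= k < i) monom (A_label (one_line sigma) k)) * monom l *
    (\prod_(i.+1 <= k < n.+2) monom (A_label (one_line sigma) k)).
  by rewrite /wt (@big_cat_nat _ _ _ i) /= ?[X in _ * X]big_ltn ?mulrA; [|lia..].
have l0 : tofrac (monom l) != 0 by rewrite tofrac_eq0 monom_neq0.
have cancel (F : fieldType) (p g q t : F) : t != 0 -> p * g * q = p * t * q * g / t.
  by move=> t0; field.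
by rewrite !tofracM; apply: cancel.
Qed.
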